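(* The problem of finding a connected component of a countable graph does not have finite tolerance.
   Context: Graphs on vertex set $\{v_i:i\in\mathbb{N}\}$ are presented as elements of $2^\omega$, namely the characteristic function of the edge set with respect to a fixed indexing $\{e_i:i\in\mathbb{N}\}$ of the edges of the complete graph on the vertices. The problem $\mathsf{P}$: an instance is such a graph, a solution is a connected component, i.e. a set $C$ of vertices any two of which are joined by a finite path and such that if $x\in C$ and $y$ is path connected to $x$ then $y\in C$. A problem $\mathsf{R}$ has finite tolerance if there is a Turing functional $\Theta$ such that whenever $B_1,B_2$ are instances of $\mathsf{R}$ with $B_1(n)=B_2(n)$ for all $n\ge m$, and $S$ is a solution of $B_1$, then $\Theta(S,m)$ is a solution of $B_2$.
   Formalization: A connected component is required to be nonempty; under the literal definition the empty set would be a solution of every instance, and the problem would trivially have finite tolerance. *)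

(* Defs.v *)
From mathcomp Require Import all_boot.

Set Implicit Arguments.
Unset Strict Implicit.
Unset Printing Implicit Defensive.

(* Elements of 2^omega, i.e. characteristic functions of subsets of omega. *)
Definition cantor := nat -> bool.

(* Turing functionals are presented as Kleene's mu-recursive schemes, by arity,
   extended with a basic function that queries the oracle. [Prec f g] recurses
   on its first argument:
     h(0, v) = f(v),   h(x+1, v) = g(x, h(x, v), v);
   [Min f] is v |-> the least y such that f(y, v) = 0 and f(z, v) is defined
   and nonzero for all z < y. *)
Inductive functional : nat -> Type :=
| Zero : functional 0
| Succ : functional 1
| Oracle : functional 1
| Proj n of 'I_n : functional n
| Comp n k of functional k & ('I_k -> functional n) : functional n
| Prec n of functional n & functional n.+2 : functional n.+1
| Min n of functional n.+1 : functional n.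

(* [converges A f v y] : with oracle A and input v, f halts with output y.
   In the case of [Prec], t lists the successive values h(0, v), h(1, v), ... *)
Fixpoint converges (A : cantor) n (f : functional n) :
    n.-tuple nat -> nat -> Prop :=
  match f in functional n return n.-tuple nat -> nat -> Prop with
  | Zero => fun _ y => y = 0
  | Succ => fun v y => y = (thead v).+1
  | Oracle => fun v y => y = A (thead v)
  | Proj _ i => fun v y => y = tnth v i
  | Comp _ k f g => fun v y =>
      exists w : k.-tuple nat,
        (forall i, converges A (g i) v (tnth w i)) /\ converges A f w y
  | Prec _ f g => fun xv y =>
      let x := thead xv in
      let v := [tuple of behead xv] in
      exists t : nat -> nat,
        [/\ converges A f v (t 0),
            forall i, i < x ->
              converges A g [tuple of i :: t i :: v] (t i.+1)
          & y = t x]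
  | Min _ f => fun v y =>
      converges A f [tuple of y :: v] 0 /\
      forall z, z < y -> exists w, converges A f [tuple of z :: v] w.+1
  end.

(* Theta(S, m) is defined and is the element T of 2^omega. *)
Definition computes (Theta : functional 2) (S : cantor) (m : nat)
    (T : cantor) : Prop :=
  forall x, converges S Theta [tuple m; x] (T x).

Record problem := Problem {
  is_instance : cantor -> Prop;
  is_solution : cantor -> cantor -> Prop (* is_solution B S: S solves B *)
}.

Definition finite_tolerance (R : problem) : Prop :=
  exists Theta : functional 2,
    forall (B1 B2 S : cantor) (m : nat),
      is_instance R B1 -> is_instance R B2 ->
      (forall n, m <= n -> B1 n = B2 n) ->
      is_solution R B1 S ->
      exists2 T : cantor, computes Theta S m T & is_solution R B2 T.

(* The edges of the complete graph on omega: the unordered pair {u, v}, u <> v,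
   is represented by (min u v, max u v). *)
Definition edge := {p : nat * nat | p.1 < p.2}.

(* An indexing {e_i} of the edges is given by the bijection idx : e_i |-> i.
   [insub] returns None exactly when u = v. *)
Definition adj (idx : edge -> nat) (B : cantor) : rel nat := fun u v =>
  if insub (minn u v, maxn u v) is Some a then B (idx a) else false.

Definition path_connected (idx : edge -> nat) (B : cantor) (u v : nat) : Prop :=
  exists2 p : seq nat, path (adj idx B) u p & last u p = v.

(* Nonemptiness is part of being a connected component; without it the empty
   set would be a solution of every instance. *)
Definition is_component (idx : edge -> nat) (B C : cantor) : Prop :=
  [/\ exists x, C x,
      forall x y, C x -> C y -> path_connected idx B x y
    & forall x y, C x -> path_connected idx B x y -> C y].

Definition component_problem (idx : edge -> nat) : problem :=
  Problem (fun _ => True) (is_component idx).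

(* Main.v *)
Require Import Defs.
From mathcomp Require Import all_boot.

(** The functional sees only the solution S and the bound m, so the instances
    from which S comes can be varied while its output T stays the same. Take
    S = {0} and m beyond the index of the edge {0, 1}. As S is a component both
    of the edgeless graph and of the complete graph on the nonzero vertices, T
    is a component of both, which forces T = {0}. But T must also be a component
    of the graph whose only edge is {0, 1}, a finite modification of the
    edgeless graph. *)

Lemma converges_inj A n (f : functional n) v y z :
  converges A f v y -> converges A f v z -> y = z.
Proof.
elim: f v y z => [|||k i|k l f IHf g IHg|k f IHf g IHg|k f IHf] v y z /=;
  try by move=> -> ->.
- move=> [w [gw fw]] [w' [gw' fw']].
  have eq_w : w = w' by apply: eq_from_tnth => i; apply: IHg (gw i) (gw' i).
  by apply: IHf fw _; rewrite eq_w.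
- move=> [t [t0 tS ->]] [t' [t'0 t'S ->]].
  (* The lists [t] and [t'] are constrained only up to [thead v], so they need agree only there. *)
  suff eq_t i : i <= thead v -> t i = t' i by apply: eq_t.
  elim: i => [_|i IHi lti]; first exact: IHf t0 t'0.
  have := t'S i lti; rewrite -(IHi (ltnW lti)).
  exact: IHg (tS i lti).
- move=> [fy lty] [fz ltz].
  case: (ltngtP y z) => // [/ltz|/lty] [w fw].
  + by have := IHf _ _ _ fy fw.
  + by have := IHf _ _ _ fz fw.
Qed.

Lemma computes_inj Theta S m T U :
  computes Theta S m T -> computes Theta S m U -> T =1 U.
Proof.
move=> ST SU x; have := converges_inj _ _ _ _ _ _ (ST x) (SU x).
by case: (T x) (U x) => [] [].
Qed.

Lemma adj_lt idx B u v (ltuv : u < v) :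
  adj idx B u v = B (idx (exist _ (u, v) ltuv)).
Proof.
rewrite /adj (minn_idPl (ltnW ltuv)) (maxn_idPr (ltnW ltuv)).
by rewrite (@insubT _ (fun p : nat * nat => p.1 < p.2) _ (u, v) ltuv).
Qed.

Lemma component_adj idx B C u v :
  is_component idx B C -> adj idx B u v -> C u -> C v.
Proof.
by move=> [_ _ closedC] uv Cu; apply: closedC Cu _; exists [:: v]; rewrite //= uv.
Qed.

Lemma path_connected_isolated idx B u v :
  (forall w, ~~ adj idx B u w) -> path_connected idx B u v -> u = v.
Proof.
by move=> isolated [[|w p] //= /andP[uw _] _]; move: (isolated w); rewrite uw.
Qed.

Lemma isolated_component idx B u :
  (forall w, ~~ adj idx B u w) -> is_component idx B (eq_op^~ u).
Proof.
move=> isolated; split; first by exists u; apply: eqxx.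
- by move=> x y /eqP-> /eqP->; exists [::].
- by move=> x y /eqP-> /(path_connected_isolated _ _ _ _ isolated) <-.
Qed.

Lemma adj_edgeless idx u v : ~~ adj idx (fun=> false) u v.
Proof. by rewrite /adj; case: insub. Qed.

Theorem theorem6p3 (idx : edge -> nat) (idx_bij : bijective idx) :
  ~ finite_tolerance (component_problem idx).
Proof.
move=> [Theta tol]; case: idx_bij => e idxK _.
pose S : cantor := eq_op^~ 0.
pose e01 : edge := exist _ (0, 1) isT.
pose m := (idx e01).+1.
(* The first entry of an edge is its smaller endpoint, so no edge kept here meets 0. *)
pose nonzero : cantor := fun n => (val (e n)).1 != 0.
have S_edgeless : is_component idx (fun=> false) S.
  by apply: isolated_component => w; apply: adj_edgeless.
have S_nonzero : is_component idx nonzero S.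
  apply: isolated_component => -[|w]; first by rewrite /adj insubF.
  by rewrite adj_lt /nonzero idxK.
(* Here and for [nonzero] the two instances are equal: tolerance only shows that the output on [S]
   and [m] is a component. *)
have [T ST [[x Tx] connT _]] :=
  tol _ (fun=> false) S m I I (fun _ _ => erefl) S_edgeless.
have [U SU compU] := tol _ nonzero S m I I (fun _ _ => erefl) S_nonzero.
have agree n : m <= n -> false = (n == idx e01).
  by move=> lt_n; rewrite gtn_eqF.
have [V SV compV] := tol _ (eq_op^~ (idx e01)) S m I I agree S_edgeless.
have TU := computes_inj _ _ _ _ _ ST SU.
have TV := computes_inj _ _ _ _ _ ST SV.
have T_single y : T y -> x = y.
  move=> Ty; apply: path_connected_isolated (connT _ _ Tx Ty).
  exact: adj_edgeless.
case: x Tx T_single {connT} => [|x] Tx T_single.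
(* The added edge [e01] carries 0 to 1, a second element of [T]. *)
- suff /T_single : T 1 by [].
  rewrite TV; apply: (component_adj _ _ _ 0 _ compV); last by rewrite -TV.
  by rewrite (adj_lt _ _ 0 1 isT).
(* In [nonzero] the vertex [x.+1] is adjacent to [x.+2], again a second element. *)
- suff /T_single/eqP : T x.+2 by rewrite ltn_eqF.
  rewrite TU; apply: (component_adj _ _ _ x.+1 _ compU); last by rewrite -TU.
  by rewrite (adj_lt _ _ _ _ (ltnSn x.+1)) /nonzero idxK.
Qed.
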